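(* Let $c,\beta,\sigma_h^2,d>0$ and $\alpha\ge 2$ be fixed. Suppose there are $N$ user equipments, all at the same distance $d$ from the power beacon, with independent instantaneous output DC powers $P_{\mathrm{out}-i}=c\beta d^{-\alpha}|h_i|^2$, $i=1,\dots,N$, where each $|h_i|^2$ is exponentially distributed with mean $\sigma_h^2$. If the user with the maximum instantaneous output DC power is chosen to be charged during each transmission slot, then as $N\to\infty$ the average output DC power $\overline{P_{\mathrm{os}}^{\mathrm{hom}}}=\mathbb{E}\left[\max_{1\le i\le N}P_{\mathrm{out}-i}\right]$ scales as $$\overline{P_{\mathrm{os}}^{\mathrm{hom}}}\sim c\,\beta\,\sigma_h^2\,d^{-\alpha}\ln N .$$
   Context: Model: a power beacon transmits power wirelessly to users. The instantaneous output DC power at user $i$ in a slot is $P_{\mathrm{out}-i}=c\beta d_i^{-\alpha}|h_i|^2$, where $d_i$ is the distance from the beacon (here $d_i=d$ for all $i$), $\alpha\ge2$ is the path-loss exponent, $\beta>0$ is a constant scaling factor, $c>0$ is a constant (depending on the rectifier parameters and proportional to the effective radiated power of the beacon), and $|h_i|^2$ is the Rayleigh multi-path fading gain, i.e. exponential with mean $\sigma_h^2>0$. Thus $P_{\mathrm{out}-i}$ has CDF $1-\exp\left(-\frac{d^\alpha}{c\beta\sigma_h^2}x\right)$ for $x\ge0$. Under opportunistic scheduling the average output DC power is the mean of the maximum of the $N$ instantaneous output powers. Notation: $f(N)\sim g(N)$ means $\lim_{N\to\infty}f(N)/g(N)=1$. *)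

(* Defs.v *)
(* MathComp-Analysis *)
From HB Require Import structures.
From mathcomp Require Import all_boot all_order all_algebra.
From mathcomp Require Import all_classical all_reals all_analysis.

Set Implicit Arguments.
Unset Strict Implicit.
Unset Printing Implicit Defensive.

Import Order.TTheory GRing.Theory Num.Theory.
Import numFieldNormedType.Exports.

Local Open Scope classical_set_scope.
Local Open Scope ring_scope.

Definition mutually_independent d (T : measurableType d) (R : realType)
    (P : probability T R) (I : finType) (X : I -> T -> R) : Prop :=
  forall (J : {set I}) (A : I -> set R),
    (forall i, i \in J -> measurable (A i)) ->
    P (\bigcap_(i in [set` J]) (X i @^-1` A i)) =
    (\prod_(i in J) P (X i @^-1` A i))%E.

(* The library's exponential law is parametrized by its rate, the inverse of
   the mean. *)
Definition exponential_with_mean d (T : measurableType d) (R : realType)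
    (P : probability T R) (m : R) (X : {RV P >-> R}) : Prop :=
  forall A : set R, measurable A ->
    distribution P X A = exponential_prob m^-1 A.

(* [g] stands for the fading power gain |h|^2. *)
Definition output_power (R : realType) (c beta alpha dist g : R) : R :=
  c * beta * dist `^ (- alpha) * g.

(* The big operator starts from one of the values [x i0], so that for N > 0 the
   result is the maximum whatever the signs; 0 is a dummy value for N = 0. *)
Definition max_over (R : realType) (N : nat) (x : 'I_N -> R) : R :=
  if [pick i : 'I_N] is Some i0 then \big[Num.max/x i0]_(i < N) x i else 0.

(* [fine] sends infinite expectations to 0. *)
Definition average_max_power d (T : measurableType d) (R : realType)
    (P : probability T R) (N : nat) (X : 'I_N -> T -> R) : R :=
  fine 'E_P[fun w => max_over (fun i => X i w)].

Definition asymp_equiv (R : realType) (f g : nat -> R) : Prop :=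
  f N / g N @[N --> \oo] --> (1 : R).

(* Main.v *)
(* Let m = c beta sigma^2 d^(-alpha) be the mean of one output power and M the
   maximum of the N powers X_i. The pointwise bound M <= a + sum_i (X_i - a)^+
   with a = m ln N gives E[M] <= m ln N + m, because E[(X_i - a)^+] = m / N.
   Conversely E[M] >= t P(M > t) for every t >= 0, and by independence
   P(M > t) = 1 - (1 - e^(-t/m))^N >= 1 - exp(-N e^(-t/m)). Writing L = ln N and
   taking t = m (L - sqrt L), the ratio E[M] / (m L) lies between
   (1 - 1/sqrt L)^2 and 1 + 1/L. Gains may be negative on a null set, so M is
   first replaced by its positive part. *)
Require Import Defs.
From HB Require Import structures.
From mathcomp Require Import all_boot all_order all_algebra.
From mathcomp Require Import all_classical all_reals all_analysis.
From mathcomp Require Import measurable_realfun ring.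

Set Implicit Arguments.
Unset Strict Implicit.
Unset Printing Implicit Defensive.

Import Order.TTheory GRing.Theory Num.Theory.
Import numFieldNormedType.Exports.

Local Open Scope classical_set_scope.
Local Open Scope ring_scope.

(** * Tail and Laplace integral of the exponential law *)

Section exponential_tail.
Context {R : realType}.

(** Integrates the density through its antiderivative [- expR (- rate * x)], which vanishes at
    infinity. *)
Lemma exponential_prob_itvoy (rate t : R) : 0 < rate -> 0 <= t ->
  exponential_prob rate `]t, +oo[ = (expR (- (rate * t)))%:E.
Proof.
move=> rate_gt0 t_ge0.
have cexp : continuous (fun x : R => - expR (- rate * x)).
  move=> x; apply: cvgN; apply: continuous_comp; last exact: continuous_expR.
  exact: mulrl_continuous.
rewrite /exponential_prob integral_itv_obnd_cbnd; last first.
  apply/measurable_EFinP/measurable_funTS.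
  exact: measurable_exponential_pdf.
rewrite (@ge0_continuous_FTC2y _ _ (fun x => - expR (- rate * x)) _ 0).
- by rewrite EFinN oppeK add0e mulNr.
- by move=> x _; apply: exponential_pdf_ge0; exact: ltW.
- apply: (@continuous_subspaceW R^o _ _ [set` `[0, +oo[%R]).
    by move=> x /=; rewrite !in_itv/= !andbT; exact: le_trans.
  exact: within_continuous_exponential_pdf.
- rewrite -oppr0; apply: cvgN.
  rewrite (_ : (fun x => expR (- rate * x)) =
               (fun z => expR (- z)) \o (fun z => rate * z)); last first.
    by apply: eq_fun => x; rewrite mulNr.
  apply: (@cvg_comp _ _ _ _ _ _ (pinfty_nbhs R)); last exact: cvgr_expR.
  exact: gt0_cvgMry.
- by move=> x _; exact: ex_derive.
- exact/cvg_at_right_filter/cexp.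
- move=> x; rewrite in_itv/= andbT => tx.
  by apply: derive1_exponential_pdf; rewrite in_itv/= andbT (le_lt_trans t_ge0).
Qed.

(** The tail at 0 says that the density has total mass 1; dividing by [rate] gives the integral. *)
Lemma integral_expRN (rate : R) : 0 < rate ->
  (\int[lebesgue_measure]_(x in `[0%R, +oo[) (expR (- (rate * x)))%:E =
   rate^-1%:E)%E.
Proof.
move=> rate_gt0.
have := exponential_prob_itvoy rate_gt0 (lexx 0).
rewrite mulr0 oppr0 expR0 /exponential_prob integral_itv_obnd_cbnd; last first.
  apply/measurable_EFinP/measurable_funTS.
  exact: measurable_exponential_pdf.
under eq_integral => x.
  rewrite inE/= in_itv/= andbT => x_ge0.
  rewrite exponential_pdfE// mulNr EFinM.
  over.
rewrite ge0_integralZl//; last 2 first.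
- by apply/measurable_EFinP/measurable_funTS/measurableT_comp => //;
    exact/measurable_funN/measurable_funM.
- by rewrite lee_fin ltW.
move=> /(congr1 (fun y => (rate^-1)%:E * y)%E).
by rewrite muleA -EFinM mulVf ?gt_eqF// mul1e mule1.
Qed.

End exponential_tail.

Lemma measurable_superlevel d (T : measurableType d) (R : realType)
    (Y : T -> R) (t : R) :
  measurable_fun setT Y -> measurable [set w | t < Y w].
Proof.
move=> mY; rewrite (_ : [set w | _] = setT `&` Y @^-1` `]t, +oo[%classic).
  exact: mY.
by apply/seteqP; split => w /=; rewrite in_itv/= andbT; [split|case].
Qed.

(** * Expectations through tail probabilities *)

Section expectation_tail.
Context d (T : measurableType d) (R : realType) (P : probability T R).
Local Open Scope ereal_scope.

Lemma ge0_expectation_tail (X : T -> R) :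
  measurable_fun setT X -> (forall w, 0 <= X w)%R ->
  'E_P[X] =
  \int[lebesgue_measure]_(r in `[0%R, +oo[) P [set w | (r < X w)%R].
Proof.
move=> mX X_ge0.
rewrite (@ge0_expectation_ccdf _ _ _ _ (mfun_Sub (mem_set mX)))//.
apply: eq_integral => r _; rewrite /ccdf /distribution /pushforward.
by congr (P _); apply/seteqP; split => w /=; rewrite in_itv/= andbT.
Qed.

(** Memorylessness: beyond the level [a] the tail is the original one scaled by [expR (- (a / m))],
    so its integral is the mean [m] times that factor. *)
Lemma expectation_excess (X : T -> R) (m a : R) : (0 < m)%R -> (0 <= a)%R ->
  measurable_fun setT X ->
  (forall t : R, 0 <= t ->
    P [set w | (t < X w)%R] = (expR (- (t / m)))%:E)%R ->
  'E_P[fun w => (Num.max (X w - a) 0)%R] = (m * expR (- (a / m)))%:E.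
Proof.
move=> m_gt0 a_ge0 mX tailX.
rewrite ge0_expectation_tail; last 2 first.
- by apply: measurable_maxr => //; exact: measurable_funB.
- by move=> w; rewrite le_max lexx orbT.
under eq_integral => r.
  rewrite inE/= in_itv/= andbT => r_ge0.
  rewrite (_ : [set w | _] = [set w | (a + r < X w)%R]); last first.
    by apply/seteqP; split => w /=; rewrite lt_max ltrBrDl (le_gtF r_ge0) orbF.
  rewrite tailX ?addr_ge0// mulrDl opprD expRD EFinM (mulrC r).
  over.
rewrite ge0_integralZl//.
- by rewrite integral_expRN ?invr_gt0// invrK -EFinM mulrC.
- by apply/measurable_EFinP/measurable_funTS/measurableT_comp => //;
    exact/measurable_funN/measurable_funM.
Qed.

(** Markov's inequality: integrate [t] times the indicator of the superlevel set, which is pointwise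
    at most [X]. *)
Lemma expectation_ge_tail (X : T -> R) (t : R) : (0 <= t)%R ->
  measurable_fun setT X -> (forall w, 0 <= X w)%R ->
  t%:E * P [set w | (t < X w)%R] <= 'E_P[X].
Proof.
move=> t_ge0 mX X_ge0.
have mA := measurable_superlevel t mX.
rewrite -[X in P X]setIT -integral_indic// -ge0_integralZl//.
- rewrite unlock; apply: ge0_le_integral => //.
  + by move=> w _; rewrite -EFinM lee_fin mulr_ge0.
  + apply/measurable_EFinP; exact: measurable_funM.
  + exact/measurable_EFinP.
  + move=> w _; rewrite -EFinM lee_fin indicE.
    case: (boolP (w \in _)) => [|_]; last by rewrite mulr0.
    by rewrite inE/= mulr1 => /ltW.
- exact/measurable_EFinP.
Qed.

End expectation_tail.

(** * The maximum of finitely many values *)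

Section max_over.
Context {R : realType}.

(** Indexing by ['I_N.+1] rules out the dummy branch of [max_over]; the starting value is itself one
    of the [x i]. *)
Lemma max_over_gtP (N : nat) (x : 'I_N.+1 -> R) (t : R) :
  reflect (exists i, t < x i) (t < max_over x).
Proof.
rewrite /max_over; case: pickP => [i0 _|/(_ ord0)//].
apply: (iffP (bigmax_gtP _ _ _ _)).
  by case=> [?|[i _ ?]]; [exists i0|exists i].
by case=> i ?; right; exists i.
Qed.

Lemma measurable_max_over d (T : measurableType d) (N : nat)
    (X : 'I_N -> T -> R) :
  (forall i, measurable_fun setT (X i)) ->
  measurable_fun setT (fun w => max_over (fun i => X i w)).
Proof.
move=> mX; rewrite /max_over.
case: pickP => [i0 _|_]; last exact: measurable_cst.
(* The starting index [i0] does not depend on [w], so induction on the list of indices suffices. *)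
elim: (index_enum _) => [|i s IHs].
  by under eq_fun do rewrite big_nil; exact: mX.
by under eq_fun do rewrite big_cons; exact: measurable_maxr.
Qed.

End max_over.

(** * Two-sided bounds on the mean of the maximum *)

Section max_of_exponentials.
Context d (T : measurableType d) (R : realType) (P : probability T R).
Variables (m : R) (N : nat) (X : 'I_N.+1 -> T -> R).
Hypothesis m_gt0 : 0 < m.
Hypothesis mX : forall i, measurable_fun setT (X i).
Hypothesis tailX : forall i (t : R), 0 <= t ->
  P [set w | t < X i w] = (expR (- (t / m)))%:E.

Let M w := max_over (fun i => X i w).

Let mM : measurable_fun setT M. Proof. exact: measurable_max_over. Qed.

Let mMp : measurable_fun setT (fun w => Num.max (M w) 0).
Proof. exact: measurable_maxr. Qed.

(* The tail at 0 gives P(X_i > 0) = 1. *)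
Lemma expectation_max_pos_part :
  ('E_P[M] = 'E_P[fun w => (Num.max (M w) 0)%R])%E.
Proof.
rewrite unlock; apply: ae_eq_integral => //; try exact/measurable_EFinP.
(* Outside this null set one of the values is positive, hence so is [M], which then equals its
   positive part. *)
exists (~` [set w | 0 < X ord0 w]); split.
- by apply: measurableC; exact: measurable_superlevel.
- transitivity (P (~` [set w | 0 < X ord0 w])) => //.
  rewrite probability_setC; last exact: measurable_superlevel.
  by rewrite tailX// mul0r oppr0 expR0 subee.
- move=> w /= /not_implyP[_ h] X0; apply: h; congr (_%:E).
  by apply/esym/max_l/ltW/max_over_gtP; exists ord0.
Qed.

(* Union bound: max_i X_i <= a + sum_i (X_i - a)^+ with a = m ln N. *)
Lemma expectation_max_le :
  ('E_P[M] <= (m * ln N.+1%:R + m)%:E)%E.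
Proof.
have N_gt0 : 0 < N.+1%:R :> R by rewrite ltr0n.
pose a := m * ln N.+1%:R.
have a_ge0 : 0 <= a by rewrite mulr_ge0 ?ln_ge0 ?ler1n// ltW.
pose E i w := Num.max (X i w - a) 0.
have E_ge0 i w : 0 <= E i w by rewrite le_max lexx orbT.
have mE i : measurable_fun setT (E i).
  by apply: measurable_maxr => //; exact: measurable_funB.
have intE i : (\int[P]_w (E i w)%:E = (m / N.+1%:R)%:E)%E.
  have := expectation_excess m_gt0 a_ge0 (mX i) (tailX i); rewrite unlock => ->.
  (* The level [a] is chosen so that [expR (- (a / m))] is [1 / N.+1]: the [N.+1] excesses then add
     up to [m]. *)
  by rewrite /a mulrAC divff ?gt_eqF// mul1r expRN lnK.
rewrite expectation_max_pos_part.
apply: (@le_trans _ _ ('E_P[fun w => (a + \sum_i E i w)%R])%E).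
  apply: expectation_le => //.
  - apply: measurable_funD => //; exact: measurable_sum.
  - by move=> w; rewrite le_max lexx orbT.
  - by move=> w; rewrite addr_ge0// sumr_ge0.
  (* Each [X i w] is at most [a + E i w], and the other excesses are nonnegative. *)
  - apply: aeW => w; rewrite ge_max addr_ge0 ?sumr_ge0// andbT leNgt.
    apply/negP => /max_over_gtP[i]; apply/negP; rewrite -leNgt.
    rewrite (bigD1 i)//= addrA ler_wpDr ?sumr_ge0// -lerBlDl.
    by rewrite le_max lexx.
rewrite unlock; under eq_integral do rewrite EFinD.
rewrite ge0_integralD//; last 2 first.
- by move=> w _; rewrite lee_fin sumr_ge0.
- by apply/measurable_EFinP; exact: measurable_sum.
rewrite integral_cst// [X in (_ * X)%E](probability_setT P) mule1.
under eq_integral do rewrite -sumEFin.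
rewrite ge0_integral_sum//; last 2 first.
- by move=> i; exact/measurable_EFinP.
- by move=> i w _; rewrite lee_fin.
under eq_bigr => i _ do rewrite intE.
rewrite sumEFin sumr_const card_ord -EFinD lee_fin.
by rewrite -(mulr_natr (m / _)) divfK ?gt_eqF.
Qed.

Hypothesis indepX : mutually_independent P X.

(** The maximum is at most [t] exactly when all values are, so independence turns the complementary
    probability into a power of [1 - expR (- (t / m))]. *)
Lemma max_tail_ge (t : R) : 0 <= t ->
  ((1 - expR (- (N.+1%:R * expR (- (t / m)))))%:E <=
     P [set w | (t < M w)%R])%E.
Proof.
move=> t_ge0.
have -> : [set w | t < M w] =
    ~` (\bigcap_(i in [set` [set: 'I_N.+1]%SET]) (X i @^-1` `]-oo, t])).
  rewrite -[LHS]setCK; congr (~` _); apply/seteqP; split => w /=.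
    move=> nM i _ /=; rewrite in_itv/= leNgt; apply/negP => Xi.
    by apply: nM; apply/max_over_gtP; exists i.
  move=> Xt /max_over_gtP[i]; apply/negP; rewrite -leNgt.
  by have /= := Xt i (finset.in_setT i); rewrite in_itv.
have pC i : X i @^-1` `]-oo, t] = ~` [set w | t < X i w].
  by apply/seteqP; split => w /=; rewrite in_itv/= leNgt => /negP.
rewrite probability_setC; last first.
  apply: fin_bigcap_measurable => // i _.
  by rewrite pC; apply: measurableC; exact: measurable_superlevel.
rewrite (indepX (fun _ _ => measurable_itv `]-oo, t])).
rewrite (eq_bigr (fun=> (1 - expR (- (t / m)))%:E)); last first.
  move=> i _; rewrite pC probability_setC; last exact: measurable_superlevel.
  by rewrite tailX.
rewrite prodEFin prodr_const cardsT card_ord lee_fin lerD2l lerN2.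
(* This is [1 - x <= expR (- x)] with [x = expR (- (t / m))], raised to the power [N.+1]. *)
rewrite -(mulrN N.+1%:R) expRM_natl lerXn2r ?nnegrE ?expR_ge0//.
- by rewrite subr_ge0 -expR0 ler_expR oppr_le0 divr_ge0// ltW.
- by rewrite expR_ge1Dx.
Qed.

Lemma expectation_max_ge (t : R) : 0 <= t ->
  ((t * (1 - expR (- (N.+1%:R * expR (- (t / m))))))%:E <= 'E_P[M])%E.
Proof.
move=> t_ge0; rewrite expectation_max_pos_part.
apply: (@le_trans _ _
  (t%:E * P [set w | (t < Num.max (M w) 0)%R])%E); last first.
  apply: expectation_ge_tail => // w.
  by rewrite le_max lexx orbT.
rewrite EFinM lee_wpmul2l ?lee_fin//.
(* As [t] is nonnegative, passing to the positive part does not change the superlevel set. *)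
rewrite (_ : [set w | _] = [set w | t < M w]); first exact: max_tail_ge.
by apply/seteqP; split => w /=; rewrite lt_max (le_gtF t_ge0) orbF.
Qed.

End max_of_exponentials.

(** * Passage to the limit *)

Section asymptotics.
Context {R : realType}.

Lemma cvg_ln_natr : ln n%:R @[n --> \oo] --> (+oo : set_system R).
Proof.
apply/cvgryPge => A; near=> n.
rewrite -(expRK A) ler_ln ?posrE ?expR_gt0//.
  by near: n; exact: nbhs_infty_ger.
by rewrite ltr0n; near: n; exact: nbhs_infty_gt.
Unshelve. all: end_near. Qed.

Lemma cvg_sqrt_pinfty : Num.sqrt x @[x --> +oo] --> (+oo : set_system R).
Proof.
apply/cvgryPge => A; near=> x.
apply: (le_trans (ler_norm A)); rewrite -sqrtr_sqr; apply: ler_wsqrtr.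
by near: x; apply: nbhs_pinfty_ge; exact: num_real.
Unshelve. all: end_near. Qed.

Lemma cvg_sqrt_lnV : (Num.sqrt (ln n%:R))^-1 @[n --> \oo] --> (0 : R).
Proof.
apply/gtr0_cvgV0; last exact: (cvg_comp _ _ cvg_ln_natr cvg_sqrt_pinfty).
near=> n; rewrite sqrtr_gt0 ln_gt0// ltr1n.
by near: n; exact: nbhs_infty_gt.
Unshelve. all: end_near. Qed.

Lemma asymp_equiv_ln_squeeze (m : R) (e : nat -> R) : 0 < m ->
  (forall N, e N.+1 <= m * ln N.+1%:R + m) ->
  (forall N t, 0 <= t ->
    t * (1 - expR (- (N.+1%:R * expR (- (t / m))))) <= e N.+1) ->
  e N / (m * ln N%:R) @[N --> \oo] --> (1 : R).
Proof.
move=> m_gt0 ub lb.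
pose u N : R := (Num.sqrt (ln N%:R))^-1.
have u0 : u N @[N --> \oo] --> (0 : R) by exact: cvg_sqrt_lnV.
(* With [u = 1 / sqrt L], the lower bound [1 - 2u] is a weakening of [(1 - u)^2], and [u * u] is
   [1 / L]. *)
apply: (@squeeze_cvgr _ _ _ _ (fun N => 1 - (u N + u N))
          (fun N => 1 + u N * u N)); last 2 first.
- rewrite -[X in _ --> X]subr0 -[X in _ - X]addr0.
  by apply: cvgB; [exact: cvg_cst|exact: cvgD].
- rewrite -[X in _ --> X]addr0 -[X in _ + X](mulr0 0).
  by apply: cvgD; [exact: cvg_cst|exact: cvgM].
near=> N.
(* This gives [1 <= s], hence [s <= L], so that the level [m * (L - s)] is nonnegative. *)
have L1 : 1 <= ln (N%:R : R).
  by near: N; move/cvgryPge: cvg_ln_natr => /(_ 1).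
have N0 : (0 < N)%N by near: N; exact: nbhs_infty_gt.
set L := ln N%:R in L1 *; pose s := Num.sqrt L.
have L0 : 0 < L by exact: lt_le_trans L1.
have s0 : 0 < s by rewrite sqrtr_gt0.
have sL : L = s * s by rewrite -expr2 sqr_sqrtr// ltW.
have s1 : 1 <= s by rewrite -sqrtr1 ler_wsqrtr.
have -> : u N = s^-1 by [].
apply/andP; split; last first.
  rewrite ler_pdivrMr ?mulr_gt0//.
  move: (ub N.-1); rewrite prednK// -/L => /le_trans; apply.
  by rewrite sL le_eqVlt; apply/orP; left; apply/eqP; field; rewrite gt_eqF.
rewrite ler_pdivlMr ?mulr_gt0//.
(* At t = m (L - sqrt L) one has N e^(-t/m) = e^(sqrt L). *)
have t0 : 0 <= m * (L - s).
  by rewrite mulr_ge0 ?(ltW m_gt0)// sL subr_ge0 ler_peMl// ltW.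
move: (lb N.-1 _ t0); rewrite prednK//; apply: le_trans.
have -> : N%:R * expR (- (m * (L - s) / m)) = expR s.
  rewrite -[N%:R]lnK ?posrE ?ltr0n// -/L -expRD; congr expR.
  by field; rewrite gt_eqF.
(* Two uses of [1 + x <= expR x] give [s <= expR s <= expR (expR s)]. *)
have es : expR (- expR s) <= s^-1.
  rewrite expRN lef_pV2 ?posrE ?expR_gt0//.
  apply: (le_trans _ (expR_ge1Dx _)); apply: ler_wpDl => //.
  by apply: (le_trans _ (expR_ge1Dx _)); rewrite ler_wpDl.
apply: (@le_trans _ _ (m * (L - s) * (1 - s^-1))); last first.
  by rewrite ler_wpM2l// lerD2l lerN2.
rewrite sL -subr_ge0.
(* With [L = s * s] the two sides are [m * (s - 1)^2] and [m * (s^2 - 2 * s)]. *)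
rewrite (_ : _ - _ = m); first exact: ltW.
by field; rewrite gt_eqF.
Unshelve. all: end_near. Qed.

End asymptotics.

Theorem theorem1 (R : realType) (c beta sigma2 dist alpha : R)
  (c_gt0 : 0 < c) (beta_gt0 : 0 < beta) (sigma2_gt0 : 0 < sigma2)
  (dist_gt0 : 0 < dist) (alpha_ge2 : 2 <= alpha)
  (disp : nat -> measure_display)
  (T : forall N : nat, measurableType (disp N))
  (P : forall N : nat, probability (T N) R)
  (gain : forall N : nat, 'I_N -> {RV (P N) >-> R})
  (gain_exp : forall (N : nat) (i : 'I_N),
     exponential_with_mean sigma2 (gain N i))
  (power_indep : forall N : nat,
     mutually_independent (P N)
       (fun (i : 'I_N) (w : T N) =>
          output_power c beta alpha dist (gain N i w))) :
  asymp_equiv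
    (fun N : nat =>
       average_max_power (P N)
         (fun (i : 'I_N) (w : T N) =>
            output_power c beta alpha dist (gain N i w)))
    (fun N : nat => c * beta * sigma2 * dist `^ (- alpha) * ln N%:R).
Proof.
set K := c * beta * dist `^ (- alpha).
have K_gt0 : 0 < K by rewrite mulr_gt0 ?powR_gt0 ?mulr_gt0.
have m_gt0 : 0 < K * sigma2 by exact: mulr_gt0.
pose X N (i : 'I_N) w := output_power c beta alpha dist (gain N i w).
have mX N (i : 'I_N) : measurable_fun setT (X N i).
  by apply: measurable_funM => //; exact: measurable_funP.
have tailX N (i : 'I_N) (t : R) : 0 <= t ->
    P N [set w | t < X N i w] = (expR (- (t / (K * sigma2))))%:E.
  move=> t_ge0.
  (* The power exceeds [t] exactly when the gain exceeds [t / K], so the power is exponential with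
     mean [K * sigma2]. *)
  have := gain_exp N i _ (measurable_itv `]t / K, +oo[).
  rewrite exponential_prob_itvoy ?invr_gt0 ?divr_ge0 ?(ltW K_gt0)//.
  rewrite mulrCA (mulrC sigma2^-1) -(invfM K) => <-.
  congr (P N _); apply/seteqP; split => w /=;
    by rewrite in_itv/= andbT ltr_pdivrMr// mulrC.
rewrite /asymp_equiv.
under eq_cvg => N.
  rewrite (_ : c * beta * sigma2 * dist `^ (- alpha) = K * sigma2); last first.
    by rewrite /K; ring.
  over.
(* Finiteness ensures that [fine] returns the true expectation; the lower bound at [t = 0] supplies
   its nonnegativity. *)
have Efin N :
    ('E_(P N.+1)[fun w => max_over (fun i => X N.+1 i w)])%E \is a fin_num.
  rewrite ge0_fin_numE.
    apply: (le_lt_trans _ (ltry _)).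
    exact: (expectation_max_le m_gt0 (mX _) (tailX _)).
  have := @expectation_max_ge _ _ _ (P N.+1) _ _ _ m_gt0 (mX _) (tailX _).
  by move=> /(_ (power_indep N.+1) 0 (lexx 0)); rewrite mul0r.
apply: asymp_equiv_ln_squeeze => // [N|N t t_ge0]; rewrite -lee_fin fineK//.
- exact: (expectation_max_le m_gt0 (mX _) (tailX _)).
- exact: (expectation_max_ge m_gt0 (mX _) (tailX _) (power_indep _)).
Qed.
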